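(* Consider the equation $$\frac{d\beta^t}{c\,dt}+\frac13\frac{d\ln\rho}{c\,dt}\,\omega\frac{\partial\beta^t}{\partial\omega}=j-\tilde\chi\beta^t-\tilde\Sigma$$ for $\beta^t=\frac12\int_{-1}^1f^t\,d\mu$. Let the background matter, i.e. $\rho$, the reaction rates $j$ and $\tilde\chi$, and the source term $\tilde\Sigma$ in this equation be in a stationary state limit, i.e. independent of time. Then $\tilde\Sigma$ is limited from above and below by $$-\chi\le\tilde\Sigma\le j .$$
   Context: Here $t$ is time, $r$ the radius, $\mu\in[-1,1]$ the cosine of the propagation angle, $\omega>0$ the energy, and $c>0$ the speed of light. $\frac{d}{dt}=\frac{\partial}{\partial t}+v\frac{\partial}{\partial r}$ is the Lagrangian (comoving) time derivative, with $v$ the radial velocity and $\rho$ the density of the background matter. The emissivity $j\ge0$ and the absorptivity $\chi\ge0$ do not depend on $\mu$, and $\tilde\chi=j+\chi$. The source term $\tilde\Sigma$ is isotropic (independent of $\mu$) and otherwise unspecified. The trapped particle component $f^t=f^t(t,r,\mu,\omega)$ of the neutrino distribution function is itself a distribution function, i.e. it takes values in $[0,1]$. The displayed equation is an approximation of the angularly integrated Boltzmann equation for neutrino transport.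
   Formalization: ''Independent of time'' is read in the comoving frame (constant along the matter's trajectories), and every element of the background matter is assumed to exist, at positive radius, for all later times; without these the bounds can fail. *)

(* Defs.v *)
From HB Require Import structures.
From mathcomp Require Import all_boot all_order all_algebra.
From mathcomp Require Import all_classical all_reals all_analysis.
Set Implicit Arguments.
Unset Strict Implicit.
Unset Printing Implicit Defensive.
Import Order.TTheory GRing.Theory Num.Theory.
Import numFieldNormedType.Exports.
Local Open Scope classical_set_scope.
Local Open Scope ring_scope.

(* Functions of (t, r) are only meaningful for t > 0 and r > 0, the energy
   variable for w > 0; values outside are junk. *)

Definition comoving_derive (R : realType) (v q : R -> R -> R) (t r : R) : R :=
  derive1 (fun s => q s r) t + v t r * derive1 (fun y => q t y) r.

Definition differentiable_tr (R : realType) (q : R -> R -> R) (t r : R) : Prop :=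
  differentiable (fun p : R * R => q p.1 p.2) (t, r).

Definition angular_mean (R : realType) (f : R -> R -> R -> R -> R)
    (t r w : R) : R :=
  2^-1 * (\int[lebesgue_measure]_(mu in `[-1, 1]) f t r mu w).

(* x t is the radius at time t >= t0 of an element of the background matter,
   which moves with radial velocity v; x is unconstrained before t0, except
   for the two-sided derivative at t0 itself. *)
Definition matter_trajectory (R : realType) (v : R -> R -> R) (t0 : R)
    (x : R -> R) : Prop :=
  forall t : R, t0 <= t -> 0 < x t /\ is_derive t 1 x (v t (x t)).

(* Every matter element exists for all later times.  Some such assumption is
   needed: with v t r = 1 + r ^+ 2, for instance, matter reaches infinity in
   finite time. *)
Definition matter_velocity (R : realType) (v : R -> R -> R) : Prop :=
  forall t0 r0 : R, 0 < t0 -> 0 < r0 ->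
    exists2 x, matter_trajectory v t0 x & x t0 = r0.

(* Independent of time in the comoving frame, in which time derivatives are
   taken: if v is a matter_velocity and q is differentiable in (t, r), this is
   comoving_derive v q = 0.  No regularity of q is required. *)
Definition stationary (R : realType) (v q : R -> R -> R) : Prop :=
  forall (t0 : R) (x : R -> R), 0 < t0 -> matter_trajectory v t0 x ->
    forall t : R, t0 <= t -> q t (x t) = q t0 (x t0).

(* Main.v *)
(* Along the trajectory of a matter element ln rho is constant, so the energy
   derivative drops out of the equation, and y(t) = beta(t, x(t), w) satisfies
   y' = c (j - chit y - Sigma) with constant j, chit and Sigma.  Since
   0 <= y <= 1 and chit >= 0, Sigma > j would give y' <= c (j - Sigma) < 0 and
   Sigma < - chi would give y' >= c (- chi - Sigma) > 0 for all later times;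
   either way y would leave [0, 1]. *)
Require Import Defs.
From HB Require Import structures.
From mathcomp Require Import all_boot all_order all_algebra.
From mathcomp Require Import all_classical all_reals all_analysis.
From mathcomp Require Import lra.
Import Order.TTheory GRing.Theory Num.Theory.
Import numFieldNormedType.Exports.
Local Open Scope classical_set_scope.
Local Open Scope ring_scope.

(** Chain rule along a plane curve. With one coordinate constant it also computes the partial
    derivatives of [q]. *)
Lemma is_derive_diff_pair (R : realType) (q : R * R -> R) (a b : R -> R)
    (t da db : R) :
  differentiable q (a t, b t) -> is_derive t 1 a da -> is_derive t 1 b db ->
  is_derive t 1 (fun s => q (a s, b s)) ('d q (a t, b t) (da, db)).
Proof.
move=> dq [a1 a2] [b1 b2].
have da1 : differentiable a t by exact/derivable1_diffP.
have db1 : differentiable b t by exact/derivable1_diffP.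
have dab : differentiable (fun s => (a s, b s)) t by exact: differentiable_pair.
have dc : differentiable (q \o (fun s => (a s, b s))) t
  by exact: differentiable_comp.
apply: DeriveDef; first exact/derivable1_diffP.
rewrite (deriveE _ dc) diff_comp //= diff_pair //=.
by rewrite -a2 -b2 !deriveE.
Qed.

(** The differential of [q] at [(t, x t)] is linear and the curve has velocity
    [(1, v) = (1, 0) + v *: (0, 1)]; its values at the two basis vectors are the partial derivatives
    in [comoving_derive]. *)
Lemma is_derive_comoving (R : realType) (v q : R -> R -> R) (x : R -> R)
    (t : R) :
  differentiable_tr q t (x t) -> is_derive t 1 x (v t (x t)) ->
  is_derive t 1 (fun s => q s (x s)) (comoving_derive v q t (x t)).
Proof.
move=> dq dx; set p : R * R -> R := fun p => q p.1 p.2.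
have qt := @is_derive_diff_pair R p id (cst (x t)) t 1 0 dq
  (is_derive_id _ _) (is_derive_cst _ _ _).
have qr := @is_derive_diff_pair R p (cst t) id (x t) 0 1 dq
  (is_derive_cst _ _ _) (is_derive_id _ _).
have qx := @is_derive_diff_pair R p id x t 1 (v t (x t)) dq
  (is_derive_id _ _) dx.
apply: (is_derive_eq qx); rewrite /comoving_derive !derive1E.
rewrite (@derive_val _ _ _ _ _ _ _ qt) (@derive_val _ _ _ _ _ _ _ qr) /=.
have -> : (1, v t (x t)) = (1, 0) + v t (x t) *: (0, 1) :> R * R.
  by congr pair; rewrite /= ?scaler0 ?addr0 ?add0r //= /GRing.scale /= mulr1.
by rewrite linearD linearZ.
Qed.

Lemma angular_mean_itv01 (R : realType) (f : R -> R -> R -> R -> R)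
    (t r w : R) :
  measurable_fun (`[-1, 1] : set R) (fun mu => f t r mu w) ->
  (forall mu, -1 <= mu <= 1 -> 0 <= f t r mu w <= 1) ->
  0 <= angular_mean f t r w <= 1.
Proof.
move=> mf f01; pose D : set R := `[-1, 1]%classic.
have mD : measurable D by exact: measurable_itv.
have fin : (lebesgue_measure D < +oo)%E.
  by rewrite /D lebesgue_measure_itv /= lte_fin; case: ifP => // _; exact: ltry.
have f0 mu : D mu -> 0 <= f t r mu w.
  by rewrite /D /= in_itv /= => /f01/andP[].
have f1 mu : D mu -> f t r mu w <= 1.
  by rewrite /D /= in_itv /= => /f01/andP[].
have intf : lebesgue_measure.-integrable D
    (EFin \o (fun mu => f t r mu w)).
  apply: measurable_bounded_integrable => //.
  exists 1; split=> // M M1 mu Dmu /=.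
  by rewrite ger0_norm ?f0// (le_trans (f1 _ Dmu))// ltW.
have int1 : lebesgue_measure.-integrable D
    (EFin \o (cst (1 : R))).
  apply: measurable_bounded_integrable => //.
  exact: bounded_cst.
have int_ge0 := @Rintegral_ge0 _ _ _ lebesgue_measure _ _ f0.
have int_le := le_Rintegral (mu := lebesgue_measure) mD intf int1 f1.
rewrite Rintegral_cst //= lebesgue_measure_itv /= lte_fin in int_le.
apply/andP; split; first by apply: mulr_ge0 int_ge0.
rewrite /angular_mean ler_pdivrMl// mulr1; apply: le_trans int_le _.
(* The measure of an interval is a conditional on the order of its endpoints; here it evaluates to
   2, which cancels the factor [2^-1]. *)
have -> /= : -1 < 1 :> R by lra.
lra.
Qed.

Lemma unbounded_of_derive_ge (R : realType) (y dy : R -> R) (a k M : R) :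
  0 < k -> (forall t, a < t -> is_derive t 1 y (dy t)) ->
  (forall t, a < t -> k <= dy t) ->
  exists2 t, a < t & M < y t.
Proof.
move=> k0 dyE dyk.
(* The mean value theorem needs continuity up to the left endpoint, while [y] is controlled only
   after [a]: hence the shift to [b]. [T] is chosen so that [k * (T - b)] is [|M - y b| + 1], more
   than the gap [M - y b]. *)
pose b := a + 1; pose T := b + (`|M - y b| + 1) / k.
have ab : a < b by rewrite ltrDl.
have d0 : 0 < (`|M - y b| + 1) / k by rewrite divr_gt0// ltr_wpDl.
have bT : b < T by rewrite ltrDl.
exists T; first exact: lt_trans bT.
have dyb s : b <= s -> is_derive s 1 y (dy s).
  by move=> bs; exact/dyE/(lt_le_trans ab).
have [||s sbT E] := @MVT _ y dy b T bT.
- by move=> s; rewrite in_itv /= => /andP[/ltW/dyb].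
- apply: derivable_within_continuous => s; rewrite in_itv /= => /andP[/dyb + _].
  by move=> [].
have /dyk ks : a < s.
  by move: sbT; rewrite in_itv /= => /andP[/(lt_trans ab)].
have : k * (T - b) <= dy s * (T - b) by rewrite ler_pM2r// subr_gt0.
rewrite -E {1}/T [b + _]addrC addrK mulrCA divff ?gt_eqF// mulr1.
have := ler_norm (M - y b); lra.
Qed.

(** By the chain rule this is the derivative of [ln rho] along the trajectory, where [rho] is
    constant from [t0] on. As [t0 < t] is strict, constancy holds on a whole neighbourhood of [t],
    as a two-sided derivative requires. *)
Lemma stationary_comoving_ln_eq0 (R : realType) (v rho : R -> R -> R)
    (x : R -> R) (t0 t : R) :
  0 < t0 -> t0 < t -> matter_trajectory v t0 x -> stationary v rho ->
  0 < rho t (x t) -> differentiable_tr rho t (x t) ->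
  comoving_derive v (fun s y => ln (rho s y)) t (x t) = 0.
Proof.
move=> t00 t0t xv srho rho0 drho.
have [_ dx] := xv _ (ltW t0t).
have dln : differentiable_tr (fun s y => ln (rho s y)) t (x t).
  rewrite /differentiable_tr.
  apply: (@differentiable_comp _ _ _ _ (fun p : R * R => rho p.1 p.2) (@ln R)) => //=.
  by apply/derivable1_diffP; have [] := is_derive1_ln rho0.
have [_ <-] := is_derive_comoving _ _ _ _ _ dln dx.
have /near_eq_derive -> :
    \forall s \near t, ln (rho s (x s)) = cst (ln (rho t0 (x t0))) s.
  by near=> s; rewrite /= (srho t0 x)// ltW//; near: s; exact: lt_nbhsr.
by rewrite derive_cst.
Unshelve. all: by end_near. Qed.

Theorem lemma2p24 (R : realType) (c : R)
  (v rho : R -> R -> R) (j chi Sigma : R -> R -> R -> R)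
  (f : R -> R -> R -> R -> R)
  (beta := angular_mean f)
  (chit := fun t r w : R => j t r w + chi t r w)
  (hc : 0 < c)
  (hv : matter_velocity v)
  (hrho : forall t r : R, 0 < t -> 0 < r -> 0 < rho t r)
  (drho : forall t r : R, 0 < t -> 0 < r -> differentiable_tr rho t r)
  (hj : forall t r w : R, 0 < t -> 0 < r -> 0 < w -> 0 <= j t r w)
  (hchi : forall t r w : R, 0 < t -> 0 < r -> 0 < w -> 0 <= chi t r w)
  (mf : forall t r w : R, 0 < t -> 0 < r -> 0 < w ->
    measurable_fun (`[-1, 1] : set R) (fun mu : R => f t r mu w))
  (hf : forall t r mu w : R, 0 < t -> 0 < r -> -1 <= mu <= 1 -> 0 < w ->
    0 <= f t r mu w <= 1)
  (dbeta_tr : forall t r w : R, 0 < t -> 0 < r -> 0 < w ->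
    differentiable_tr (fun s y => beta s y w) t r)
  (dbeta_w : forall t r w : R, 0 < t -> 0 < r -> 0 < w ->
    derivable (beta t r) w 1)
  (heq : forall t r w : R, 0 < t -> 0 < r -> 0 < w ->
    comoving_derive v (fun s y => beta s y w) t r / c
    + 3^-1 * (comoving_derive v (fun s y => ln (rho s y)) t r / c)
        * w * derive1 (beta t r) w
    = j t r w - chit t r w * beta t r w - Sigma t r w)
  (srho : stationary v rho)
  (sj : forall w : R, 0 < w -> stationary v (fun t r => j t r w))
  (schit : forall w : R, 0 < w -> stationary v (fun t r => chit t r w))
  (sSigma : forall w : R, 0 < w -> stationary v (fun t r => Sigma t r w)) :
  forall t r w : R, 0 < t -> 0 < r -> 0 < w ->
    - chi t r w <= Sigma t r w <= j t r w.
Proof.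
move=> t0 r0 w t00 r00 w0.
(* The given point becomes the start of a trajectory, so the bounds concern the values at [t0],
   which stationarity carries to all later times. *)
have [x xv <-] := hv t0 r0 t00 r00.
have xpos t : t0 < t -> 0 < x t by move=> /ltW/xv[].
have beta01 t : t0 < t -> 0 <= beta t (x t) w <= 1.
  move=> t0t; have t_gt0 := lt_trans t00 t0t.
  apply: angular_mean_itv01; first exact: mf (xpos _ t0t) w0.
  by move=> mu mu1; apply: hf => //; exact: xpos.
set J := j t0 (x t0) w; set S := Sigma t0 (x t0) w; set X := chi t0 (x t0) w.
have JX0 : 0 <= J + X.
  by have [x0 _] := xv t0 (lexx _); rewrite addr_ge0 ?hj ?hchi.
pose y t := beta t (x t) w.
pose dy t := c * (J - (J + X) * y t - S).
have dyE t : t0 < t -> is_derive t 1 y (dy t).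
  move=> t0t; have t_gt0 := lt_trans t00 t0t; have xt := xpos _ t0t.
  have [_ dx] := xv _ (ltW t0t).
  apply: is_derive_eq; first exact:
    (is_derive_comoving _ _ (fun s y => beta s y w) _ _ (dbeta_tr t _ w t_gt0 xt w0) dx).
  (* With the [ln rho] term zero and the coefficients replaced by their values at [t0], multiplying
     the equation by [c] gives [dy t]. *)
  have := heq t (x t) w t_gt0 xt w0.
  rewrite (@stationary_comoving_ln_eq0 _ v rho x t0 t)//; [|exact: hrho|exact: drho].
  rewrite mul0r mulr0 !mul0r addr0.
  rewrite (sj w w0 t0 x t00 xv t (ltW t0t)) (schit w w0 t0 x t00 xv t (ltW t0t)).
  rewrite (sSigma w w0 t0 x t00 xv t (ltW t0t)) -/J -/S /chit -/J -/X => E.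
  by rewrite /dy /y -E mulrC divfK// gt_eqF.
apply/andP; split; rewrite leNgt; apply/negP => SE.
- have k0 : 0 < c * (- X - S) by rewrite mulr_gt0// subr_gt0.
  (* The rate comes from replacing [y t] by its upper bound 1, which cancels [J]. *)
  have [|t t0t] := @unbounded_of_derive_ge _ y dy t0 _ 1 k0 dyE.
    move=> t /beta01/andP[_ y1]; rewrite /dy ler_pM2l//.
    have : (J + X) * y t <= (J + X) * 1 by rewrite ler_wpM2l.
    lra.
  by rewrite ltNge; have /andP[_ ->] := beta01 t t0t.
- have k0 : 0 < c * (S - J) by rewrite mulr_gt0// subr_gt0.
  (* Applied to [- y], the growth lemma with threshold 0 makes [y] negative at some later time. *)
  have [||t t0t] := @unbounded_of_derive_ge _ (- y) (fun t => - dy t) t0 _ 0 k0.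
  + by move=> t /dyE dyt; exact: is_deriveN.
  + move=> t /beta01/andP[y0 _]; rewrite /dy -mulrN ler_pM2l//.
    have : 0 <= (J + X) * y t by rewrite mulr_ge0.
    lra.
  by rewrite oppr_gt0 ltNge; have /andP[-> _] := beta01 t t0t.
Qed.
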